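(* For every simple graph $G$, $M^{\mathbb{R}}_{\mathcal{Z}}(G) \leq Z_{\pm}(P_{\mathcal{Z}}(G))$.
   Context: Let $G$ be a simple graph on vertex set $\{1,\dots,n\}$. The graph of a real symmetric $n\times n$ matrix $A$ is $G$ if for $i\neq j$, $A_{ij}\neq 0$ iff $i\sim j$. $\mathcal{Z}$ is the family of real symmetric matrices all of whose nonzero off-diagonal entries share the same weak sign. $M^{\mathbb{R}}_{\mathcal{Z}}(G)$ is the maximum nullity of a matrix in $\mathcal{Z}$ whose graph is $G$. $P_{\mathcal{Z}}(G)$ is the sign pattern with $P_{ii}=?$, $P_{ij}=-$ if $i\sim j$, and $P_{ij}=0$ if $i\neq j$, $i\not\sim j$. A sign pattern is an $n\times n$ array $P$ with entries in $\{+,-,0,?\}$. Signed zero forcing game on $P$: each vertex is black or white; a white vertex may carry a marker $m(w)\in\{+,-\}$ (write $m(w)=*$ if unmarked; markers disappear when a vertex is colored black). Initially a set $S$ is black, all others white and unmarked. Write $\iota(+)=-$, $\iota(-)=+$, $s\cdot t=+$ if $s=t$ and $-$ otherwise. A move: let $u$ be a vertex that is black, or white with $P_{uu}\neq ?$; let $W$ be the set of white vertices $w$ (possibly $w=u$) with $P_{uw}\in\{+,-\}$; $W_+=\{w\in W: m(w)=P_{uw}\}$, $W_-=\{w\in W: m(w)\neq *, m(w)\neq P_{uw}\}$, $W_*=\{w\in W: m(w)=*\}$. (a) If $W=\{w\}$, color $w$ black. (b) If $W_+=W$ or $W_-=W$, color all of $W$ black. (c) If $W_s\neq\emptyset$,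 $W_{\iota(s)}=\emptyset$, $W_*=\{w\}$ for some $s$, mark $w$ with $P_{uw}\cdot\iota(s)$. (d) If no white vertex is marked, any white vertex may be marked $+$. $S$ is a signed zero forcing set if some sequence of moves makes all vertices black; $Z_{\pm}(P)$ is the minimum size of such a set. *)

(* Defs.v *)
From HB Require Import structures.
From mathcomp Require Import all_boot all_order all_algebra.
From mathcomp Require Import boolp reals.
From Stdlib Require Import Relation_Operators.

Set Implicit Arguments.
Unset Strict Implicit.
Unset Printing Implicit Defensive.

Import Order.TTheory GRing.Theory Num.Theory.

Local Open Scope nat_scope.

Definition simple_graph (n : nat) (e : rel 'I_n) : Prop :=
  symmetric e /\ irreflexive e.

Section MaximumNullity.
Local Open Scope ring_scope.
Variables (R : realType) (n : nat).
Implicit Types (A : 'M[R]_n) (e : rel 'I_n).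

Definition matrix_of_graph A e : Prop :=
  forall i j, i != j -> (A i j != 0) = e i j.

Definition calZ A : Prop :=
  A^T = A /\
  ((forall i j, i != j -> 0 <= A i j) \/ (forall i j, i != j -> A i j <= 0)).

(* [kermx] is the kernel of the action on row vectors; for the symmetric
   matrices considered here it agrees with the kernel on column vectors. *)
Definition nullity A : nat := \rank (kermx A).

(* A nullity is at most n, and the set of nullities is never empty (take minus
   the adjacency matrix), so this is a genuine maximum, not the default 0. *)
Definition max_nullity_Z e : nat :=
  \max_(k < n.+1 |
        `[< exists A, [/\ calZ A, matrix_of_graph A e & nullity A = k] >]) k.

End MaximumNullity.

Inductive sign := Plus | Minus.

Definition bool_of_sign (s : sign) : bool := if s is Plus then true else false.
Definition sign_of_bool (b : bool) : sign := if b then Plus else Minus.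
Lemma bool_of_signK : cancel bool_of_sign sign_of_bool.
Proof. by case. Qed.
HB.instance Definition _ := Finite.copy sign (can_type bool_of_signK).

Definition sopp (s : sign) : sign := if s is Plus then Minus else Plus.
Definition smul (s t : sign) : sign := if s == t then Plus else Minus.

(* Entries of a sign pattern: [Sgn Plus], [Sgn Minus], 0 and ?. *)
Inductive entry := Sgn of sign | Zero | Unknown.

Definition entry_sign (x : entry) : option sign :=
  if x is Sgn s then Some s else None.

Definition is_unknown (x : entry) : bool := if x is Unknown then true else false.

Definition sign_pattern (n : nat) := 'I_n -> 'I_n -> entry.

Section SignedZeroForcing.
Variables (n : nat) (P : sign_pattern n).

(* [marker st w = None] means that w carries no marker; black vertices never
   carry one. *)
Record state := State {
  black : {set 'I_n};
  marker : {ffun 'I_n -> option sign}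
}.

Definition initial (S : {set 'I_n}) : state := State S [ffun=> None].

Definition blacken (st : state) (B : {set 'I_n}) : state :=
  State (black st :|: B)
        [ffun v => if v \in B then None else marker st v].

Definition mark (st : state) (w : 'I_n) (s : sign) : state :=
  State (black st) [ffun v => if v == w then Some s else marker st v].

Definition can_act (st : state) (u : 'I_n) : bool :=
  (u \in black st) || ~~ is_unknown (P u u).

Definition W (st : state) (u : 'I_n) : {set 'I_n} :=
  [set w | (w \notin black st) && (entry_sign (P u w) != None)].

Definition W_sgn (st : state) (u : 'I_n) (s : sign) : {set 'I_n} :=
  match s with
  | Plus => [set w in W st u | marker st w == entry_sign (P u w)]
  | Minus => [set w in W st u |
               (marker st w != None) && (marker st w != entry_sign (P u w))]
  end.

Definition W_star (st : state) (u : 'I_n) : {set 'I_n} :=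
  [set w in W st u | marker st w == None].

Inductive move (st : state) : state -> Prop :=
| move_single u w of can_act st u & W st u = [set w] :
    move st (blacken st [set w])
| move_all u s of can_act st u & W_sgn st u s = W st u :
    move st (blacken st (W st u))
| move_mark u s w t of can_act st u & W_sgn st u s <> set0
    & W_sgn st u (sopp s) = set0 & W_star st u = [set w]
    & P u w = Sgn t :
    move st (mark st w (smul t (sopp s)))
| move_free w of (forall v, v \notin black st -> marker st v = None)
    & w \notin black st :
    move st (mark st w Plus).

Definition signed_zero_forcing (S : {set 'I_n}) : Prop :=
  exists st, clos_refl_trans_1n _ move (initial S) st /\ black st = [set: 'I_n].

(* The full vertex set is always signed zero forcing, so the minimum exists. *)
Definition Zpm : nat :=
  #|[arg min_(S < [set: 'I_n] | `[< signed_zero_forcing S >]) #|S|]|.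

End SignedZeroForcing.

Definition pattern_Z (n : nat) (e : rel 'I_n) : sign_pattern n :=
  fun i j => if i == j then Unknown else if e i j then Sgn Minus else Zero.

(* Main.v *)
(** A kernel vector of a matrix that realizes the pattern and vanishes on a
    forcing set must vanish: along the game, the black vertices carry zero
    coordinates, and the markers record the weak signs of the other coordinates
    up to one global sign. Each move reads off the next piece of information
    from row [u] of [A x = 0]. Hence the kernel embeds into the coordinates
    indexed by a forcing set. *)
Require Import Defs.
From mathcomp Require Import all_boot all_order all_algebra.
From mathcomp Require Import reals.
From mathcomp Require Import boolp.
From Stdlib Require Import Relation_Operators.

Set Implicit Arguments.
Unset Strict Implicit.
Unset Printing Implicit Defensive.

Import Order.TTheory GRing.Theory Num.Theory.

Local Open Scope ring_scope.

Section SignValue.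
Variable R : realFieldType.
Implicit Types s t : sign.

Definition sign_val s : R := if s is Plus then 1 else -1.

Lemma sign_val_smul s t : sign_val (smul s t) = sign_val s * sign_val t.
Proof. by case: s t => [] [] /=; rewrite ?mulN1r ?mul1r ?opprK. Qed.

Lemma sign_val_sopp s : sign_val (sopp s) = - sign_val s.
Proof. by case: s => //=; rewrite opprK. Qed.

Lemma sign_val_sqr s : sign_val s * sign_val s = 1.
Proof. by case: s => /=; rewrite ?mulrNN mulr1. Qed.

Lemma sign_val_neq0 s : sign_val s != 0.
Proof. by case: s => /=; rewrite ?oppr_eq0 oner_eq0. Qed.

End SignValue.

Section KernelVectors.
Variables (R : realFieldType) (n : nat) (P : sign_pattern n).
Implicit Types (A : 'M[R]_n) (x : 'cV[R]_n) (st : state n).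

Definition realizes A : Prop :=
  (forall i j t, P i j = Sgn t -> 0 < sign_val R t * A i j) /\
  (forall i j, P i j = Zero -> A i j = 0).

(** The factor c may have either sign because a free move always marks [Plus], whatever the true
    sign of the coordinate. The inequality is weak because a marked coordinate may still be zero. *)
Definition compatible x st : Prop :=
  (forall w, w \in black st -> x w 0 = 0) /\
  exists2 c : R, c != 0 &
    forall w s, marker st w = Some s -> 0 <= sign_val R s * (c * x w 0).

Variables (A : 'M[R]_n) (x : 'cV[R]_n).
Hypotheses (unknown_diag : forall i j, P i j = Unknown -> i = j)
  (PA : realizes A) (Ax0 : A *m x = 0).

(** Only indices in [W] survive in row u of [A *m x = 0]: black coordinates vanish, zero entries
    contribute nothing, and an unknown entry can only be diagonal, where [can_act] forces u to be
    black. *)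
Lemma row_sum_W st u (c : R) :
    (forall w, w \in black st -> x w 0 = 0) -> can_act P st u ->
  \sum_(w in W P st u) A u w * (c * x w 0) = 0.
Proof.
move=> xb act_u; transitivity (c * (A *m x) u 0); last first.
  by rewrite Ax0 mxE mulr0.
rewrite mxE big_distrr /= [RHS](bigID (mem (W P st u))) /= [X in _ + X]big1.
  by rewrite addr0; apply: eq_bigr => w _; rewrite mulrCA.
move=> w; rewrite inE negb_and negbK => /orP[wb|].
  by rewrite xb // !mulr0.
case Puw: (P u w) => [t| |] //= _.
  by rewrite PA.2 // mul0r mulr0.
have uw := unknown_diag Puw.
by move: act_u; rewrite /can_act {1 3}uw Puw orbF => /xb->; rewrite !mulr0.
Qed.

Lemma mem_W st u w :
  w \in W P st u -> exists t, P u w = Sgn t.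
Proof.
by rewrite inE => /andP[_]; case: (P u w) => // t _; exists t.
Qed.

Lemma realizes_neq0 st u w : w \in W P st u -> A u w != 0.
Proof.
case/mem_W=> t /PA.1; apply: contraTneq => ->.
by rewrite mulr0 ltxx.
Qed.

(** An entry of sign t times a coordinate of weak sign m has weak sign m t, which is + when marker
    and pattern agree and - when they differ. *)
Lemma W_sgn_sign st u s w (c : R) :
    (forall v m, marker st v = Some m -> 0 <= sign_val R m * (c * x v 0)) ->
  w \in W_sgn P st u s -> 0 <= sign_val R s * (A u w * (c * x w 0)).
Proof.
move=> xm ws.
have /mem_W[t Puw] : w \in W P st u by case: (s) ws => /setIdP[].
have key m : marker st w = Some m ->
    0 <= sign_val R m * sign_val R t * (A u w * (c * x w 0)).
  move=> /xm xw; rewrite [_ * sign_val R t]mulrC mulrACA.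
  by rewrite mulr_ge0 // ltW // PA.1.
case: s ws => /setIdP[_]; rewrite Puw /=.
  by move=> /eqP/key; rewrite sign_val_sqr.
case/andP; case mw: (marker st w) => [m|] // _; move: (key _ mw).
by case: (m) (t) => [] []; rewrite /= ?mulr1 ?mul1r ?eqxx.
Qed.

Lemma compatible_blacken st (B : {set 'I_n}) :
    compatible x st -> (forall w, w \in B -> x w 0 = 0) ->
  compatible x (blacken st B).
Proof.
move=> [xb [c c0 xm]] xB; split=> [w|].
  by case/setUP; [apply: xb | apply: xB].
by exists c => // w s; rewrite ffunE; case: ifP => // _ /xm.
Qed.

Lemma compatible_move st st' :
  move P st st' -> compatible x st -> compatible x st'.
Proof.
move=> mv cst; have [xb [c c0 xm]] := cst.
have xW0 u w : w \in W P st u -> A u w * (c * x w 0) = 0 -> x w 0 = 0.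
  move=> /realizes_neq0 Auw /eqP.
  by rewrite !mulf_eq0 (negPf Auw) (negPf c0) => /eqP.
case: mv => [u w act_u Ww | u s act_u Ws | u s w t act_u _ Ws' Wstar Puw
           | w unmarked _].
- apply: compatible_blacken => // v /set1P->; apply: (xW0 u).
    by rewrite Ww set11.
  by have := row_sum_W c xb act_u; rewrite Ww big_set1.
(* All terms of the row sum share the weak sign s, so the zero sum makes each of them vanish. *)
- apply: compatible_blacken => // w Ww; apply: (xW0 u) => //.
  apply: (mulfI (sign_val_neq0 R s)); rewrite mulr0.
  have sum0 : \sum_(v in W P st u) sign_val R s * (A u v * (c * x v 0)) = 0.
    by rewrite -big_distrr /= row_sum_W ?mulr0.
  have ge0 v : v \in W P st u -> 0 <= sign_val R s * (A u v * (c * x v 0)).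
    by rewrite -Ws; apply: W_sgn_sign.
  by move/psumr_eq0P: sum0; apply.
- split=> //; exists c => // v m; rewrite ffunE; case: eqP => [->{v} [<-]|_ /xm//].
  have wW : w \in W P st u.
    have: w \in W_star P st u by rewrite Wstar set11.
    by case/setIdP.
  (* The term at w is minus the sum of the others. These all have weak sign s, so it has weak sign
     [sopp s]. *)
  have := row_sum_W c xb act_u; rewrite (bigD1 w) //= => /eqP.
  rewrite addr_eq0 => /eqP sumW.
  rewrite sign_val_smul sign_val_sopp -mulrA.
  have tA : 0 < sign_val R t * A u w by apply: PA.1.
  (* Multiplying the goal by this positive number cancels the sign t and makes the term at w
     appear. *)
  rewrite -(pmulr_rge0 _ tA) mulrACA mulrA sign_val_sqr mul1r.
  rewrite mulrCA sumW mulrNN mulr_sumr sumr_ge0 // => v /andP[vW vw].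
  have mv : marker st v != None.
    by apply: contraNneq vw => mv; rewrite -in_set1 -Wstar inE vW mv.
  (* A marked v in [W] that is outside the empty class of [sopp s] lies in the class of s. *)
  apply: (W_sgn_sign xm); have := in_set0 v; rewrite -Ws'.
  by case: (s) => /= /negbT; rewrite inE vW /= ?mv ?negbK => vs;
    rewrite inE vW ?mv.
(* With no white vertex marked, the old c binds no white coordinate, so the global sign can be
   chosen afresh to make the coordinate at w nonnegative. *)
- split=> //; pose d : R := if 0 <= x w 0 then 1 else -1.
  exists d => [|v m]; first by rewrite /d; case: ifP; rewrite ?oppr_eq0 oner_eq0.
  rewrite ffunE; case: eqP => [-> [<-]|_ mv].
    rewrite mul1r /d; case: (leP 0 (x w 0)) => [|/ltW]; rewrite ?mul1r //.
    by rewrite mulN1r oppr_ge0.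
  have [/xb->|/unmarked] := boolP (v \in black st); first by rewrite !mulr0.
  by rewrite mv.
Qed.

Lemma compatible_moves st st' :
  clos_refl_trans_1n _ (move P) st st' -> compatible x st -> compatible x st'.
Proof. by elim=> // {}st st1 st2 /compatible_move mv _ IH /mv/IH. Qed.

Lemma kernel_eq0_on_forcing (S : {set 'I_n}) :
  signed_zero_forcing P S -> (forall w, w \in S -> x w 0 = 0) -> x = 0.
Proof.
case=> st [mvs stT] xS.
have [] : compatible x st.
  apply: compatible_moves mvs _; split=> //.
  by exists 1; rewrite ?oner_eq0 // => w s; rewrite ffunE.
rewrite stT => x0 _; apply/matrixP=> i j.
by rewrite ord1 mxE x0 ?inE.
Qed.

End KernelVectors.

(** The matrix [D] keeps the coordinates in S. By hypothesis it is injective on the kernel, whose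
    dimension is thus at most the number of columns of [D]. *)
Lemma mxrank_kermx_le (F : fieldType) (m n : nat) (A : 'M[F]_(m, n))
    (S : {set 'I_m}) :
    (forall x : 'rV_m, x *m A = 0 -> (forall w, w \in S -> x 0 w = 0) -> x = 0) ->
  (\rank (kermx A) <= #|S|)%N.
Proof.
move=> kerS; pose D : 'M[F]_(m, #|S|) := colsub enum_val 1%:M.
rewrite -(mxrank_mul_ker (kermx A) D) [X in (_ + X)%N](_ : _ = 0%N).
  by rewrite addn0 rank_leq_col.
apply/eqP; rewrite mxrank_eq0; apply/rowV0P => x.
rewrite sub_capmx => /andP[/sub_kermxP xA /sub_kermxP xD].
apply: kerS => // w wS; move/matrixP/(_ 0 (enum_rank_in wS w)): xD.
by rewrite mulmx_colsub mulmx1 !mxE enum_rankK_in.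
Qed.

Lemma nullity_opp (R : realType) n (A : 'M[R]_n) : nullity (- A) = nullity A.
Proof. by rewrite /nullity !mxrank_ker mxrank_opp. Qed.

Lemma realizes_pattern_Z (R : realType) n (e : rel 'I_n) (A : 'M[R]_n) :
    matrix_of_graph A e -> (forall i j, i != j -> A i j <= 0) ->
  realizes (pattern_Z e) A.
Proof.
move=> Ae Ale0; split=> [i j t|i j]; rewrite /pattern_Z.
  case: (eqVneq i j) => // ij; case eij: (e i j) => // -[<-] /=.
  by rewrite mulN1r oppr_gt0 lt_neqAle Ae // eij Ale0.
case: (eqVneq i j) => // ij; case eij: (e i j) => // _.
by apply/eqP; rewrite -[_ == _]negbK Ae ?eij.
Qed.

Lemma nullity_le_forcing (R : realType) n (e : rel 'I_n) (A : 'M[R]_n)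
    (S : {set 'I_n}) :
    calZ A -> matrix_of_graph A e -> signed_zero_forcing (pattern_Z e) S ->
  (nullity A <= #|S|)%N.
Proof.
move=> [AT Asign] Ae forceS.
(* Negation preserves symmetry, graph and nullity, and reduces to the sign that fits [pattern_Z]. *)
wlog Ale0 : A AT Asign Ae / forall i j, i != j -> A i j <= 0.
  move=> hA; case: (Asign) => [Age0|]; last exact: hA.
  have NAle0 i j : i != j -> (- A) i j <= 0 by rewrite mxE oppr_le0; apply: Age0.
  rewrite -nullity_opp; apply: hA => //; first by rewrite linearN /= AT.
    by right.
  by move=> i j ij; rewrite mxE oppr_eq0 Ae.
(* Since A is symmetric, the transpose of a row vector in the kernel solves the column equation used
   along the game. *)
apply: mxrank_kermx_le => x xA xS; apply: trmx_inj; rewrite trmx0.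
apply: (@kernel_eq0_on_forcing _ _ (pattern_Z e) A _ _ _ _ S) => //.
- by move=> i j; rewrite /pattern_Z; case: eqP => // _; case: ifP.
- exact: realizes_pattern_Z.
- by rewrite -{1}AT -trmx_mul xA trmx0.
- by move=> w wS; rewrite mxE xS.
Qed.

Theorem mainTheorem2 (R : realType) (n : nat) (e : rel 'I_n)
    (He : simple_graph e) :
  (max_nullity_Z R e <= Zpm (pattern_Z e))%N.
Proof.
apply/bigmax_leqP => k /asboolP[A [ZA Ae <-]].
rewrite /Zpm; case: arg_minnP => [|S /asboolP forceS _]; last first.
  exact: nullity_le_forcing forceS.
(* The default candidate of the minimum, the full vertex set, is forcing with no move at all. *)
by apply/asboolP; exists (initial [set: 'I_n]); split=> //; apply: rt1n_refl.
Qed.
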